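(* Let $\mathcal{L}=\{H_i\}_{i\in I}$ and $\mathcal{E}=\{E_j\}_{j\in J}$ be partitions of $\Omega$ ($I,J$ arbitrary), let $\mathcal{A}_{\mathcal L},\mathcal{A}_{\mathcal E},\mathcal{A}$ be Boolean algebras with $\langle\mathcal L\rangle\subseteq\mathcal A_{\mathcal L}\subseteq\langle\mathcal L\rangle^*$, $\langle\mathcal E\rangle\subseteq\mathcal A_{\mathcal E}\subseteq\langle\mathcal E\rangle^*$, $\langle\mathcal A_{\mathcal L}\cup\mathcal A_{\mathcal E}\rangle\subseteq\mathcal A\subseteq\langle\mathcal A_{\mathcal L}\cup\mathcal A_{\mathcal E}\rangle^*$. Let $\sigma$ be a strategy on $\mathcal A\times\mathcal L$ and $\pi$ a finitely additive probability on $\mathcal A_{\mathcal L}$. Then the lower joint probability $\underline{P}^{\mathbf j}=\min\mathcal P^{\mathbf j}$ satisfies, for every $F\in\mathcal A$, $$\underline{P}^{\mathbf j}(F)=\sup_{\mathcal L^{\mathcal F}\subseteq\mathcal A_{\mathcal L}}\left\{\sum_{h=1}^n\sigma(F|H_{i_h})\,\pi(H_{i_h})+\sum_{B_k\subseteq F}\pi(B_k)\right\},$$ where $\mathcal L^{\mathcal F}=\{H_{i_h}\}_{h=1}^n\cup\{B_k\}_{k=1}^t$ ranges over the finite partitions of $\Omega$ contained in $\mathcal A_{\mathcal L}$, with $H_{i_h}\in\mathcal L$ and $B_k\in\mathcal A_{\mathcal L}$.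
   Context: Events are elements of a Boolean algebra with operations $\wedge,\vee,(\cdot)^c$, implication order $\subseteq$, top $\Omega$ and bottom $\emptyset$; $\mathcal A^0=\mathcal A\setminus\{\emptyset\}$. For a set $\mathcal G$ of events, $\langle\mathcal G\rangle$ is the Boolean algebra generated by $\mathcal G$, and $\langle\mathcal G\rangle^*$ is the complete atomic Boolean algebra generated by $\mathcal G$ (the minimal atomic Boolean algebra containing $\mathcal G$ and closed under arbitrary conjunctions and disjunctions). A partition of $\Omega$ is a family of pairwise incompatible non-impossible events with disjunction $\Omega$. The atoms of $\mathcal A$ are the events $H_i\wedge E_j\neq\emptyset$. A conditional event $E|H$ is a pair of events $(E,H)$ with $H\neq\emptyset$. Strategy: a map $\sigma:\mathcal A\times\mathcal L\to[0,1]$ such that for every $H_i\in\mathcal L$: (S1) $\sigma(F|H_i)=1$ for every $F\in\mathcal A$ with $F\wedge H_i=H_i$; (S2) $\sigma(\cdot|H_i)$ is a finitely additive probability on $\mathcal A$. Coherence: a function $P:\mathcal G\to[0,1]$ on a set $\mathcal G$ of conditional events is a coherent conditional probability if for every $n\in\mathbb N$, $E_1|H_1,\ldots,E_n|H_n\in\mathcal G$ and real $s_1,\ldots,s_n$, the gain $G=\sum_{j=1}^n s_j(\mathbf 1_{E_j}-P(E_j|H_j))\mathbf 1_{H_j}$ satisfies $\min_{C\subseteq H_0^0}G(C)\le0\le\max_{C\subseteq H_0^0}G(C)$, where $H_0^0=\bigvee_{j=1}^nH_j$ and $C$ ranges over the atoms of $\langle\{E_j,H_j\}_{j=1,\ldots,n}\rangle$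 contained in $H_0^0$. Joint probabilities: $\mathcal P^{\mathbf j}$ is the set of finitely additive probabilities $\tilde P^{\mathbf j}$ on $\mathcal A$ such that $\tilde P^{\mathbf j}|_{\mathcal A_{\mathcal L}}=\pi$ and $\{\tilde P^{\mathbf j},\sigma\}$ is a coherent conditional probability on $\mathcal A\times(\{\Omega\}\cup\mathcal L)$ (with $\tilde P^{\mathbf j}(F)$ the value at $F|\Omega$). Its pointwise envelopes are $\underline P^{\mathbf j}=\min\mathcal P^{\mathbf j}$, $\overline P^{\mathbf j}=\max\mathcal P^{\mathbf j}$. *)

(* Defs.v *)
From HB Require Import structures.
From mathcomp Require Import all_boot all_order all_algebra.
From mathcomp Require Import boolp classical_sets reals.
Set Implicit Arguments.
Unset Strict Implicit.
Unset Printing Implicit Defensive.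
Import Order.TTheory GRing.Theory Num.Theory.
Local Open Scope classical_set_scope.
Local Open Scope ring_scope.

Definition is_minimum (R : realType) (S : set R) (m : R) : Prop :=
  S m /\ lbound S m.

Definition is_maximum (R : realType) (S : set R) (m : R) : Prop :=
  S m /\ ubound S m.

(* Events are the elements of a Boolean algebra T; Omega is \top, the impossible
   event is \bot and implication is the order. Neither completeness nor
   atomicity of T is assumed. *)
Section Events.
Variables (d : Order.disp_t) (T : ctbDistrLatticeType d).

(* The disjunction of an arbitrary family is its least upper bound in T. *)
Definition is_partition (K : Type) (H : K -> T) : Prop :=
  [/\ forall k, H k <> \bot%O,
      forall k l, k <> l -> Order.meet (H k) (H l) = \bot%O &
      supremums (range H) \top%O].

Definition is_subalgebra (A : set T) : Prop :=
  [/\ A \bot%O, A \top%O,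
      forall x, A x -> A (Order.compl x),
      forall x y, A x -> A y -> A (Order.meet x y) &
      forall x y, A x -> A y -> A (Order.join x y)].

Definition generated (G : set T) : set T := smallest is_subalgebra G.

Definition is_atom (A : set T) (C : T) : Prop :=
  [/\ A C, C <> \bot%O &
      forall x, A x -> (x <= C)%O -> x = \bot%O \/ x = C].

(* Arbitrary disjunctions and conjunctions are those of T: they are required to
   exist in T and to belong to A. *)
Definition is_complete_atomic (A : set T) : Prop :=
  [/\ is_subalgebra A,
      forall S, S `<=` A -> exists2 x, A x & supremums S x,
      forall S, S `<=` A -> exists2 x, A x & infimums S x &
      forall x, A x -> x <> \bot%O -> exists2 C, is_atom A C & (C <= x)%O].

(* "S is <G>^*". This is a relation because T need not be complete; there is at
   most one such S. *)
Definition is_complete_generated (G S : set T) : Prop :=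
  [/\ is_complete_atomic S, G `<=` S &
      forall S', is_complete_atomic S' -> G `<=` S' -> S `<=` S'].

Variable R : realType.

(* Functions on a subset of T are total functions whose values outside that
   subset are never used. *)
Definition is_fa_probability (A : set T) (P : T -> R) : Prop :=
  [/\ forall x, A x -> 0 <= P x,
      P \top%O = 1 &
      forall x y, A x -> A y -> Order.meet x y = \bot%O ->
        P (Order.join x y) = P x + P y].

(* [sigma F H] is the value at F|H. *)
Definition is_strategy (A L : set T) (sigma : T -> T -> R) : Prop :=
  [/\ forall F H, A F -> L H -> 0 <= sigma F H <= 1,
      forall F H, A F -> L H -> Order.meet F H = H -> sigma F H = 1 &
      forall H, L H -> is_fa_probability A (sigma^~ H)].

(* On an atom C of an algebra containing x, the indicator of x is 1 if C <= x
   and 0 otherwise. *)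
Definition indicator (x C : T) : R := if (C <= x)%O then 1 else 0.

Definition gain (P : T -> T -> R) (n : nat) (E H : 'I_n -> T) (s : 'I_n -> R)
    (C : T) : R :=
  \sum_(j < n) s j * (indicator (E j) C - P (E j) (H j)) * indicator (H j) C.

(* The values of the gain on the atoms of <{E_j, H_j}> contained in the
   disjunction of the H_j. *)
Definition gain_values (P : T -> T -> R) (n : nat) (E H : 'I_n -> T)
    (s : 'I_n -> R) : set R :=
  [set gain P E H s C | C in
    [set C | is_atom (generated (range E `|` range H)) C /\
             (C <= \join_(j < n) H j)%O]].

(* G is a set of pairs (E, H), read as conditional events E|H. The bets range
   over n >= 1, the minimum over an empty set of atoms being undefined. *)
Definition is_coherent (G : set (T * T)) (P : T -> T -> R) : Prop :=
  [/\ forall E H, G (E, H) -> H <> \bot%O,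
      forall E H, G (E, H) -> 0 <= P E H <= 1 &
      forall (n : nat) (E H : 'I_n -> T) (s : 'I_n -> R), (0 < n)%N ->
        (forall j, G (E j, H j)) ->
        exists m M, [/\ is_minimum (gain_values P E H s) m,
                        is_maximum (gain_values P E H s) M & m <= 0 <= M]].

(* The assessment {P, sigma} is the function Q on A x ({Omega} u L) with
   Q(F|Omega) = P(F) and Q(F|H) = sigma(F|H); if Omega belongs to L, such a Q
   exists only when P = sigma(.|Omega) on A. *)
Definition joint_probabilities (A AL L : set T) (sigma : T -> T -> R)
    (pi : T -> R) : set (T -> R) :=
  [set P | [/\ is_fa_probability A P,
      forall B, AL B -> P B = pi B &
      exists Q : T -> T -> R,
        [/\ is_coherent (A `*` ([set \top%O] `|` L)) Q,
            forall F, A F -> Q F \top%O = P F &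
            forall F H, A F -> L H -> Q F H = sigma F H]]].

(* The finite partition {H_(i_h)}_h u {B_k}_k of Omega, as a family indexed by
   the disjoint union of the two index sets. *)
Definition finite_family (I : Type) (H : I -> T) (n t : nat) (i : 'I_n -> I)
    (B : 'I_t -> T) (k : 'I_n + 'I_t) : T :=
  match k with inl h => H (i h) | inr l => B l end.

Definition lower_sums (I : Type) (H : I -> T) (AL : set T)
    (sigma : T -> T -> R) (pi : T -> R) (F : T) : set R :=
  [set v | exists (n t : nat) (i : 'I_n -> I) (B : 'I_t -> T),
    [/\ forall k, AL (B k),
        is_partition (finite_family H i B) &
        v = \sum_(h < n) sigma F (H (i h)) * pi (H (i h))
            + \sum_(k < t | (B k <= F)%O) pi (B k)]].

End Events.

(* Main.v *)
(** Let [lam F] be the supremum of the sums [sum_(h in K) sigma(F|h) pi(h) +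
    pi(B \ K)] over the finite sets [K] of blocks of L and the [B <= F] in AL.
    Enlarging [K] only increases such a sum, so that two of them can be compared
    over a common [K], where they are modular in [F] and [B]: hence [lam] is
    supermodular.  A maximal supermodular function above [lam] is a finitely
    additive probability [P], and [P F = lam F] can be arranged for one given
    [F].  Passing to complements, [P >= lam] forces [P = pi] on AL and
    [P(F /\ h) = sigma(F|h) pi(h)].  This product rule is equivalent to the
    coherence of [P, sigma]: a finite family of bets has zero expected gain under
    [P], or, if all its conditioning events are blocks of L, under [sigma(.|h)]
    for one of these blocks [h]. *)
Require Import Defs.
From mathcomp Require Import all_boot all_order all_algebra.
From mathcomp Require Import boolp classical_sets reals.
From mathcomp Require Import ring lra.
Local Open Scope classical_set_scope.
Local Open Scope ring_scope.

Set Implicit Arguments.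
Unset Strict Implicit.
Unset Printing Implicit Defensive.
Import Order.Theory GRing.Theory Num.Theory.

Local Notation "x `/\ y" := (Order.meet x y) (at level 48, left associativity).
Local Notation "x `\/ y" := (Order.join x y) (at level 52, left associativity).
Local Notation "¬ x" := (Order.compl x) (at level 35, right associativity).

(** Turns an inequality between suprema into one between elements, the form in which supermodularity
    of a supremum is proved. *)
Lemma sup_add_le (R : realType) (U V : set R) (M : R) :
  U !=set0 -> V !=set0 -> (forall u v, U u -> V v -> u + v <= M) ->
  sup U + sup V <= M.
Proof.
move=> U0 V0 UV.
have supU v : V v -> sup U <= M - v.
  by move=> Vv; apply: ge_sup => // u Uu; rewrite lerBrDr UV.
by rewrite addrC -lerBrDr; apply: ge_sup => // v /supU; rewrite lerBrDr addrC -lerBrDr.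
Qed.

(** * Finitely additive probabilities on a subalgebra *)

Section Additive.
Variables (R : realType) (d : Order.disp_t) (T : ctbDistrLatticeType d).
Variable A : set T.
Hypothesis algA : is_subalgebra A.
Implicit Types x y z : T.

Lemma subalgebraC x : A x -> A (¬ x). Proof. by case: algA => _ _ + _ _; apply. Qed.
Lemma subalgebraI x y : A x -> A y -> A (x `/\ y). Proof. by case: algA => _ _ _ + _; apply. Qed.
Lemma subalgebraU x y : A x -> A y -> A (x `\/ y). Proof. by case: algA => _ _ _ _; apply. Qed.
Lemma subalgebra0 : A \bot%O. Proof. by case: algA. Qed.
Lemma subalgebra1 : A \top%O. Proof. by case: algA. Qed.

Lemma subalgebra_joins (K : Type) (r : seq K) (Q : pred K) (F : K -> T) :
  (forall k, Q k -> A (F k)) -> A (\join_(k <- r | Q k) F k)%O.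
Proof.
by move=> AF; elim/big_ind: _ => //; [exact: subalgebra0|exact: subalgebraU].
Qed.

Variable P : T -> R.
Hypothesis probP : is_fa_probability A P.

Lemma fa_ge0 x : A x -> 0 <= P x. Proof. by case: probP => + _ _; apply. Qed.

Lemma fa1 : P \top%O = 1. Proof. by case: probP. Qed.

Lemma faU x y : A x -> A y -> x `/\ y = \bot%O -> P (x `\/ y) = P x + P y.
Proof. by case: probP => _ _; apply. Qed.

Lemma fa0 : P \bot%O = 0.
Proof.
have := faU subalgebra0 subalgebra0 (meetxx _).
by rewrite joinxx => /eqP; rewrite -subr_eq subrr => /eqP.
Qed.

Lemma fa_split y x : A x -> A y -> P x = P (x `/\ y) + P (x `/\ ¬ y).
Proof.
move=> Ax Ay; have ANy := subalgebraC Ay.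
rewrite -faU; [|exact: subalgebraI|exact: subalgebraI|].
- by rewrite -meetUr joinxC meetx1.
- by rewrite meetACA meetxC meetx0.
Qed.

Lemma faC x : A x -> P (¬ x) = 1 - P x.
Proof.
by move=> Ax; rewrite -fa1 (fa_split subalgebra1 Ax) !meet1x addrC addKr.
Qed.

Lemma le_fa x y : A x -> A y -> (x <= y)%O -> P x <= P y.
Proof.
move=> Ax Ay xy; rewrite (fa_split Ay Ax) (meet_r xy) lerDl.
by apply: fa_ge0; apply: subalgebraI => //; exact: subalgebraC.
Qed.

Lemma fa_le1 x : A x -> P x <= 1.
Proof. by move=> Ax; rewrite -fa1 le_fa ?lex1//; exact: subalgebra1. Qed.

Lemma fa_modular x y : A x -> A y -> P (x `\/ y) + P (x `/\ y) = P x + P y.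
Proof.
move=> Ax Ay.
rewrite (fa_split (subalgebraU Ax Ay) Ay) joinIK [P x](fa_split Ax Ay).
rewrite meetUl meetxC joinx0; lra.
Qed.

Lemma fa_joins (K : eqType) (r : seq K) (F : K -> T) :
  {in r, forall k, A (F k)} -> uniq r ->
  {in r &, forall k l, k != l -> F k `/\ F l = \bot%O} ->
  P (\join_(k <- r) F k)%O = \sum_(k <- r) P (F k).
Proof.
elim: r => [|k r IHr] AF /=; first by rewrite !big_nil fa0.
have rkr l : l \in r -> l \in k :: r by rewrite in_cons orbC => ->.
have Ar : {in r, forall l, A (F l)} by move=> l /rkr; exact: AF.
move=> /andP[kr /(IHr Ar) Pr] disj; rewrite !big_cons faU ?Pr//.
- by move=> l m /rkr lr /rkr; exact: disj.
- exact/AF/mem_head.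
- by rewrite big_seq; exact: subalgebra_joins.
- apply/eqP; rewrite disj_leC lexC big_seq.
  apply: joins_le => l lr; rewrite lexC -disj_leC; apply/eqP/disj.
  + exact: mem_head.
  + exact: rkr.
  + by apply: contraNneq kr => ->.
Qed.

End Additive.

(** * Supermodular capacities and the additive probabilities above them *)

Section Supermodular.
Variables (R : realType) (d : Order.disp_t) (T : ctbDistrLatticeType d).
Variable A : set T.
Hypothesis algA : is_subalgebra A.
Implicit Types (w : T -> R) (x y z : T).

Definition supermodular_capacity w :=
  [/\ w \bot%O = 0, w \top%O = 1,
      forall x y, A x -> A y -> (x <= y)%O -> w x <= w y &
      forall x y, A x -> A y -> w x + w y <= w (x `\/ y) + w (x `/\ y)].

(* [tilt w x] dominates [w] and is additive on [x] and its complement. *)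
Definition tilt w x y := w (y `/\ x) + w (y `\/ x) - w x.

Lemma tilt_ge w x y : supermodular_capacity w -> A x -> A y -> w y <= tilt w x y.
Proof. by case=> _ _ _ wS Ax Ay; rewrite /tilt; have := wS y x Ay Ax; lra. Qed.

(** Meeting and joining with [x] are lattice morphisms, so the first two terms of [tilt] inherit
    monotonicity and supermodularity; subtracting [w x] restores the values 0 and 1 at the
    bounds. *)
Lemma supermodular_capacity_tilt w x :
  A x -> supermodular_capacity w -> supermodular_capacity (tilt w x).
Proof.
move=> Ax [w0 w1 wM wS]; rewrite /tilt; split=> [||y z Ay Az yz|y z Ay Az].
- by rewrite meet0x join0x w0; lra.
- by rewrite meet1x join1x w1; lra.
- have := wM _ _ (subalgebraI algA Ay Ax) (subalgebraI algA Az Ax) (leI2 yz (lexx x)).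
  have := wM _ _ (subalgebraU algA Ay Ax) (subalgebraU algA Az Ax) (leU2 yz (lexx x)).
  lra.
- have := wS _ _ (subalgebraI algA Ay Ax) (subalgebraI algA Az Ax).
  have := wS _ _ (subalgebraU algA Ay Ax) (subalgebraU algA Az Ax).
  rewrite -meetUl meetACA meetxx -joinIl joinACA joinxx; lra.
Qed.

(** Upper bounds of chains for Zorn's lemma. For supermodularity, members [u] and [v] used at [x]
    and [y] are both replaced by the larger of the two. *)
Lemma capacity_chain_sup (C : set (T -> R)) :
  C !=set0 -> C `<=` supermodular_capacity ->
  total_on C (fun u v => forall y, A y -> u y <= v y) ->
  supermodular_capacity (fun y => sup [set u y | u in C]) /\
  forall u y, C u -> A y -> u y <= sup [set u y | u in C].
Proof.
move=> [u0 Cu0] Ccap Ctot.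
have A0 := subalgebra0 algA; have A1 := subalgebra1 algA.
have C0 y : [set u y | u in C] !=set0 by exists (u0 y), u0.
have Cub y : A y -> has_ubound [set u y | u in C].
  move=> Ay; exists 1 => _ [u Cu <-]; have [_ <- + _] := Ccap _ Cu.
  by apply=> //; exact: lex1.
have Cle u y : C u -> A y -> u y <= sup [set u y | u in C].
  by move=> Cu Ay; apply: ub_le_sup; [exact: Cub|exists u].
have Ceq y c : (forall u, C u -> u y = c) -> sup [set u y | u in C] = c.
  move=> uc; rewrite -[RHS]sup1; congr sup; apply/seteqP; split => [_ [u Cu <-]|_ ->].
    exact: uc.
  by exists u0 => //; exact: uc.
split=> //; split.
- by apply: Ceq => u /Ccap[].
- by apply: Ceq => u /Ccap[].
- move=> x y Ax Ay xy; apply: ge_sup => // _ [u Cu <-].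
  by apply: le_trans (Cle u y Cu Ay); have [_ _ + _] := Ccap _ Cu; apply.
- move=> x y Ax Ay; apply: sup_add_le => // _ _ [u Cu <-] [v Cv <-].
  have AU := subalgebraU algA Ax Ay; have AI := subalgebraI algA Ax Ay.
  have bnd w : C w -> w x + w y <=
      sup [set u (x `\/ y) | u in C] + sup [set u (x `/\ y) | u in C].
    move=> Cw; have [_ _ _ wS] := Ccap _ Cw; apply: le_trans (wS _ _ Ax Ay) _.
    by rewrite lerD// Cle.
  have [uv|vu] := Ctot u v Cu Cv.
  + by apply: le_trans (bnd v Cv); rewrite lerD2r uv.
  + by apply: le_trans (bnd u Cu); rewrite lerD2l vu.
Qed.

(* A capacity that is maximal above [w] equals all its tilts, hence is modular. *)
Lemma supermodular_capacity_le_fa w : supermodular_capacity w ->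
  exists2 P, is_fa_probability A P & forall y, A y -> w y <= P y.
Proof.
move=> wcap.
pose Q u := supermodular_capacity u /\ forall y, A y -> w y <= u y.
pose S := {u | Q u}.
(* Values outside [A] are not compared, so this is only a preorder. *)
pose leS (u v : S) := `[< forall y, A y -> sval u y <= sval v y >].
have w_in : Q w by split.
have [||C Ctot|[u [ucap wu]] umax] := @ZL_preorder S (exist Q w w_in) leS.
- by move=> u; apply/asboolP.
- move=> v u t /asboolP uv /asboolP vt; apply/asboolP => y Ay.
  exact: le_trans (uv y Ay) (vt y Ay).
- have [C0|/set0P[u0 Cu0]] := eqVneq C set0.
    by exists (exist Q w w_in) => u; rewrite C0.
  have [||| scap Cle] := @capacity_chain_sup [set sval u | u in C].
  + by exists (sval u0), u0.
  + by move=> _ [u _ <-]; have [] := svalP u.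
  + move=> _ _ [u Cu <-] [v Cv <-].
    by have [/asboolP|/asboolP] := Ctot u v Cu Cv; [left|right].
  have ws : forall y, A y -> w y <= sup [set u y | u in [set sval u | u in C]].
    move=> y Ay; apply: le_trans (Cle (sval u0) y _ Ay); last by exists u0.
    by have [_] := svalP u0; apply.
  exists (exist Q _ (conj scap ws)) => u Cu; apply/asboolP => y Ay /=.
  by apply: Cle => //; exists u.
exists u => //; have [u0 u1 uM _] := ucap; split=> // [x Ax|x y Ax Ay xy0].
  by rewrite -u0 uM ?le0x//; exact: subalgebra0.
have wt z : A z -> w z <= tilt u y z.
  by move=> Az; apply: le_trans (wu z Az) (tilt_ge ucap Ay Az).
(* Maximality bounds [tilt u y x] by [u x]; as [x] and [y] are disjoint, this is subadditivity of
   [u], and [tilt_ge] gives the converse. *)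
pose t : S := exist Q _ (conj (supermodular_capacity_tilt Ay ucap) wt).
have /asboolP/(_ _ Ax) /= : leS t (exist Q u (conj ucap wu)).
  by apply: umax; apply/asboolP => z Az /=; exact: tilt_ge.
have := tilt_ge ucap Ay Ax.
rewrite /tilt xy0 u0; lra.
Qed.

(** A probability above the tilt of [w] at [F] is at least [1 - w F] on the complement of [F], hence
    at most [w F] on [F]. *)
Lemma supermodular_capacity_touch w F : supermodular_capacity w -> A F ->
  exists P, [/\ is_fa_probability A P, forall y, A y -> w y <= P y & P F <= w F].
Proof.
move=> wcap AF.
have [P probP tP] := supermodular_capacity_le_fa (supermodular_capacity_tilt AF wcap).
exists P; split=> // [y Ay|].
  exact: le_trans (tilt_ge wcap AF Ay) (tP y Ay).
have := tP _ (subalgebraC algA AF); have [w0 w1 _ _] := wcap.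
by rewrite (faC algA probP AF) /tilt meetCx joinCx w0 w1; lra.
Qed.

End Supermodular.

(** * Atoms of a finitely generated algebra *)

Section Cells.
Variables (d : Order.disp_t) (T : ctbDistrLatticeType d).
Implicit Types (s : seq T) (x y c : T).

Lemma subalgebra_generated (G : set T) : is_subalgebra (generated G).
Proof.
by split=> [M [[]]|M [[]]|x Gx M GM|x y Gx Gy M GM|x y Gx Gy M GM] //;
  case: (GM) => -[_ _ MC MI MU] _; [apply: MC; exact: Gx | apply: MI; [exact: Gx|exact: Gy]
  | apply: MU; [exact: Gx|exact: Gy]].
Qed.

(** One entry for each choice of signs of the generators; [\bot] may occur, even repeatedly, and the
    other entries are the atoms of the generated algebra. *)
Fixpoint cells s : seq T :=
  if s is g :: s' then
    [seq (c `/\ g) | c <- cells s'] ++ [seq (c `/\ ¬ g) | c <- cells s']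
  else [:: \top%O].

Lemma cells_sub (A : set T) s : is_subalgebra A -> [set` s] `<=` A ->
  [set` cells s] `<=` A.
Proof.
move=> algA; elim: s => [|g s IHs] /= sA x /=.
  by rewrite inE => /eqP ->; exact: subalgebra1.
have Ag : A g by apply: sA; rewrite /= mem_head.
have {}IHs : [set` cells s] `<=` A.
  by apply: IHs => y ys; apply: sA; rewrite /= in_cons ys orbT.
by rewrite mem_cat => /orP[] /mapP[c /IHs Ac ->]; apply: subalgebraI => //;
  exact: subalgebraC.
Qed.

(** Thanks to this, an event decides a whole generated algebra as soon as it decides the
    generators. *)
Lemma subalgebra_decided c :
  is_subalgebra [set x | (c <= x)%O \/ c `/\ x = \bot%O].
Proof.
split=> /= [||y|y z|y z].
- by right; rewrite meetx0.
- by left; exact: lex1.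
- case=> cy; [right; apply/eqP|left]; first by rewrite disj_leC complK.
  by rewrite -disj_leC cy.
- case=> cy; last by right; rewrite meetA cy meet0x.
  case=> cz; last by right; rewrite meetCA cz meetx0.
  by left; rewrite lexI cy.
- case=> cy; first by left; rewrite (le_trans cy) ?leUl.
  case=> cz; first by left; rewrite (le_trans cz) ?leUr.
  by right; rewrite meetUr cy cz joinx0.
Qed.

Lemma cell_decides s c x : c \in cells s -> generated [set` s] x ->
  (c <= x)%O \/ c `/\ x = \bot%O.
Proof.
move=> cs; apply: (smallest_sub (subalgebra_decided c)).
move=> y /=; elim: s c cs => // g s IHs c /=.
rewrite mem_cat in_cons => /orP[] /mapP[b bs ->] /predU1P[->|ys].
- by left; rewrite leIr.
- have [by_|by0] := IHs b bs ys; first by left; rewrite (le_trans _ by_) ?leIl.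
  by right; rewrite meetAC by0 meet0x.
- by right; rewrite -meetA meetCx meetx0.
- have [by_|by0] := IHs b bs ys; first by left; rewrite (le_trans _ by_) ?leIl.
  by right; rewrite meetAC by0 meet0x.
Qed.

Lemma meet_cells s x : x <> \bot%O -> exists2 c, c \in cells s & x `/\ c <> \bot%O.
Proof.
elim: s x => [|g s IHs] x x0 /=; first by exists \top%O; rewrite ?mem_head// meetx1.
have [c cs xc] := IHs x x0.
have [xcg|/eqP xcg] := eqVneq (x `/\ (c `/\ g)) \bot%O.
  exists (c `/\ ¬ g); first by rewrite mem_cat (map_f (fun b => b `/\ ¬ g)) ?orbT.
  by move=> xcNg; apply: xc; rewrite -[LHS]meetx1 -(joinxC g) meetUr -!meetA xcg xcNg joinxx.
by exists (c `/\ g) => //; rewrite mem_cat (map_f (fun b => b `/\ g)).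
Qed.

Lemma cell_atom s c : c \in cells s -> c <> \bot%O -> is_atom (generated [set` s]) c.
Proof.
move=> cs c0; split=> //.
  by apply: cells_sub cs; [exact: subalgebra_generated|exact: sub_gen_smallest].
move=> x sx xc; have [cx|cx] := cell_decides cs sx.
  by right; apply/le_anti; rewrite xc.
by left; rewrite -cx (meet_r xc).
Qed.

(** The atom meets some cell; that cell decides the atom, hence lies below it and equals it by
    minimality. *)
Lemma atom_cell s c : is_atom (generated [set` s]) c -> c \in cells s.
Proof.
move=> [sc c0 atomc]; have [b bs cb] := meet_cells s c0.
have [bc|bc] := cell_decides bs sc; last by case: cb; rewrite meetC.
have sb : generated [set` s] b.
  by apply: cells_sub bs; [exact: subalgebra_generated|exact: sub_gen_smallest].
have [b0|<- //] := atomc b sb bc.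
by case: cb; rewrite b0 meetx0.
Qed.

Lemma fa_cells (R : realType) (A : set T) (P : T -> R) s x :
  is_subalgebra A -> is_fa_probability A P -> [set` s] `<=` A -> A x ->
  P x = \sum_(c <- cells s) P (x `/\ c).
Proof.
move=> algA probP; elim: s x => [|g s IHs] x sA Ax /=.
  by rewrite big_seq1 meetx1.
have Ag : A g by apply: sA; rewrite /= mem_head.
have {}sA : [set` s] `<=` A by move=> y ys; apply: sA; rewrite /= in_cons ys orbT.
rewrite big_cat !big_map /= -big_split (IHs x)//= big_seq [RHS]big_seq.
apply: eq_bigr => c cs; rewrite !meetA; apply: (fa_split algA probP) => //.
by apply: subalgebraI => //; exact: cells_sub cs.
Qed.

End Cells.

(** * Coherence as a product rule *)

Lemma seq_minimum (K : Type) (R : realType) (f : K -> R) (k : K) (s : seq K) :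
  exists2 m, m \in map f (k :: s) & all (>= m) (map f (k :: s)).
Proof.
elim: s k => [|l s IHs] k; first by exists (f k); rewrite /= ?mem_head ?lexx.
have [m ml mmin] := IHs l; have [km|/ltW mk] := leP (f k) m.
  exists (f k); first exact: mem_head.
  rewrite /= lexx; apply/sub_all: mmin => y /=; exact: le_trans.
by exists m; rewrite /= ?in_cons ?mk// -in_cons ml orbT.
Qed.

Section Coherence.
Variables (R : realType) (d : Order.disp_t) (T : ctbDistrLatticeType d).
Implicit Types (x y c : T).

Lemma indicatorI x y c :
  indicator R (x `/\ y) c = indicator R x c * indicator R y c.
Proof. by rewrite /indicator lexI; do 2?case: (_ <= _)%O; rewrite ?mulr1 ?mulr0. Qed.

(** The product rule makes the [P]-expectation of the gain zero, and [P] is concentrated on the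
    finitely many atoms below the disjunction of the [H j]; a mean lies between minimum and
    maximum. *)
Lemma gain_values_minimum_maximum (A : set T) (P : T -> R) (Q : T -> T -> R)
    (n : nat) (E H : 'I_n -> T) (s : 'I_n -> R) :
  is_subalgebra A -> is_fa_probability A P ->
  (forall j, A (E j)) -> (forall j, A (H j)) ->
  (forall j, P (E j `/\ H j) = Q (E j) (H j) * P (H j)) ->
  P (\join_(j < n) H j)%O = 1 ->
  exists m M, [/\ is_minimum (gain_values Q E H s) m,
                  is_maximum (gain_values Q E H s) M & m <= 0 <= M].
Proof.
move=> algA probP AE AH QP PJ; set J := (\join_(j < n) H j)%O in PJ *.
have AJ : A J by apply: subalgebra_joins.
pose g := codom E ++ codom H.
have gE : range E `|` range H = [set` g].
  apply/seteqP; split=> x /=; rewrite mem_cat.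
    by case=> -[j _ <-]; rewrite codom_f ?orbT.
  by case/orP => /codomP[j ->]; [left|right]; exists j.
have gA : [set` g] `<=` A by rewrite -gE => _ [] [j _ <-].
have Eg j : generated [set` g] (E j).
  by apply: sub_gen_smallest; rewrite -gE; left; exists j.
have Hg j : generated [set` g] (H j).
  by apply: sub_gen_smallest; rewrite -gE; right; exists j.
have alg_g := subalgebra_generated [set` g].
have genA : generated [set` g] `<=` A by exact: smallest_sub.
(* [\bot] must go: it is no atom, and lying below every event it would have all indicators equal to
   1. *)
pose S := [seq c <- cells g | (c != \bot%O) && (c <= J)%O].
have gvE : gain_values Q E H s = [set` map (gain Q E H s) S].
  rewrite /gain_values gE; apply/seteqP; split=> v /=.
    move=> [c [atomc cJ] <-]; apply: map_f; rewrite mem_filter cJ atom_cell//.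
    by case: atomc => _ /eqP ->.
  case/mapP=> c; rewrite mem_filter => /andP[/andP[/eqP c0 cJ] cg] ->.
  by exists c => //; split=> //; exact: cell_atom.
have sumS x : generated [set` g] x ->
    \sum_(c <- S) P c * indicator R x c = P (x `/\ J).
  move=> gx; rewrite big_filter big_mkcond.
  rewrite (fa_cells algA probP gA (subalgebraI algA (genA _ gx) AJ)).
  have gJ : generated [set` g] J by apply: (subalgebra_joins alg_g).
  apply: eq_big_seq => c cg /=; rewrite /indicator.
  have [->|c0] := eqVneq c \bot%O; first by rewrite meetx0 (fa0 algA probP).
  have [cJ|cJ] := cell_decides cg gJ; last first.
    rewrite -meetA [J `/\ c]meetC cJ meetx0 (fa0 algA probP).
    by case: ifPn => //= /meet_l cJc; rewrite -cJc cJ eqxx in c0.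
  rewrite cJ -meetA (meet_r cJ); have [cx|cx] := cell_decides cg gx.
    by rewrite cx mulr1 (meet_r cx).
  rewrite meetC cx (fa0 algA probP).
  by case: ifPn => [/meet_l cxc|]; rewrite ?mulr0//; rewrite -cxc cx eqxx in c0.
have sumS1 : \sum_(c <- S) P c = 1.
  rewrite -PJ -[J]meet1x -sumS; last exact: subalgebra1.
  by apply: eq_bigr => c _; rewrite /indicator lex1 mulr1.
(* By [sumS] the bet [j] has expectation [s j] times the defect of the product rule for [E j] and
   [H j]. *)
have gain0 : \sum_(c <- S) P c * gain Q E H s c = 0.
  under eq_bigr do rewrite /gain mulr_sumr.
  rewrite exchange_big big1//= => j _.
  transitivity (s j * \sum_(c <- S) (P c * indicator R (E j `/\ H j) c -
                  Q (E j) (H j) * (P c * indicator R (H j) c))).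
    by rewrite mulr_sumr; apply: eq_bigr => c _; rewrite indicatorI; ring.
  have HJ : (H j <= J)%O by rewrite /J; exact: (@joins_sup _ _ _ j xpredT H isT).
  rewrite sumrB -mulr_sumr !sumS//; last exact: (subalgebraI alg_g).
  by rewrite -meetA (meet_l HJ) QP subrr mulr0.
have P0 c : c \in S -> 0 <= P c.
  rewrite mem_filter => /andP[_ cg]; apply: (fa_ge0 probP).
  exact: (cells_sub algA gA).
rewrite gvE; case S_ : S => [|c0 S'].
  by move/eqP: sumS1; rewrite S_ big_nil eq_sym oner_eq0.
have [m mS mle] := seq_minimum (gain Q E H s) c0 S'.
(* The maximum is obtained as minus the minimum of the opposite gain. *)
have [M MS leM] := seq_minimum (fun c => - gain Q E H s c) c0 S'.
rewrite -S_ in mS mle MS leM *.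
have {}mle c : c \in S -> m <= gain Q E H s c.
  by move=> cS; apply: (allP mle); exact: map_f.
have {}leM c : c \in S -> gain Q E H s c <= - M.
  move=> cS; rewrite lerNr; apply: (allP leM).
  exact: (map_f (fun c => - gain Q E H s c)).
exists m, (- M); split; [split=> //|split|apply/andP; split].
- by move=> _ /mapP[c cS ->]; exact: mle.
- by case/mapP: MS => c cS -> /=; rewrite opprK; exact: map_f.
- by move=> _ /mapP[c cS ->]; exact: leM.
- rewrite -gain0 -[leLHS]mul1r -sumS1 mulr_suml big_seq [leRHS]big_seq.
  by apply: ler_sum => c cS; rewrite ler_wpM2l ?P0 ?mle.
- rewrite -gain0 -[leRHS]mul1r -sumS1 mulr_suml big_seq [leRHS]big_seq.
  by apply: ler_sum => c cS; rewrite ler_wpM2l ?P0 ?leM.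
Qed.

(* The bets on [F /\ h | \top], [F | h] and [h | \top] with the stakes below
   yield the same gain on every atom. *)
Lemma coherent_product_rule (G : set (T * T)) (Q : T -> T -> R) (F h : T) :
  is_coherent G Q -> G (F `/\ h, \top%O) -> G (F, h) -> G (h, \top%O) ->
  Q (F `/\ h) \top%O = Q F h * Q h \top%O.
Proof.
move=> [_ _ cohQ] GFh GF Gh.
pose E (j : 'I_3) := nth \top%O [:: F `/\ h; F; h] j.
pose H (j : 'I_3) := nth \top%O [:: \top%O; h; \top%O] j.
pose s (j : 'I_3) := nth 0 [:: 1; -1; - Q F h] j.
have gainE v : gain_values Q E H s v -> v = Q F h * Q h \top%O - Q (F `/\ h) \top%O.
  move=> [c _ <-]; rewrite /gain !big_ord_recr big_ord0 /= /E /H /s /= indicatorI.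
  have -> : indicator R (\top%O : T) c = 1 by rewrite /indicator lex1.
  ring.
have [||m [M [[/gainE mE _] [/gainE ME _]]]] := cohQ 3 E H s.
- by [].
- by case=> -[|[|[|]]].
(* Minimum and maximum of a constant gain coincide, so coherence forces both to be 0. *)
- by rewrite mE ME => /le_anti; lra.
Qed.

Lemma strategy_disjoint (A L : set T) (sigma : T -> T -> R) x h :
  is_subalgebra A -> L `<=` A -> is_strategy A L sigma ->
  A x -> L h -> x `/\ h = \bot%O -> sigma x h = 0.
Proof.
move=> algA LA [_ s1 sfa] Ax Lh xh; have probh := sfa _ Lh; have Ah := LA _ Lh.
apply/le_anti; rewrite (fa_ge0 probh)// andbT.
rewrite (le_trans (y := sigma (¬ h) h))//.
  apply: (le_fa algA probh) => //; first exact: subalgebraC.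
  by rewrite -disj_leC xh.
by rewrite (faC algA probh)// s1 ?meetxx// subrr.
Qed.

Lemma strategy_meet (A L : set T) (sigma : T -> T -> R) x h :
  is_subalgebra A -> L `<=` A -> is_strategy A L sigma ->
  A x -> L h -> sigma (x `/\ h) h = sigma x h.
Proof.
move=> algA LA strat Ax Lh; have [_ _ sfa] := strat; have Ah := LA _ Lh.
rewrite [RHS](fa_split algA (sfa _ Lh) Ax Ah).
rewrite [X in _ + X](strategy_disjoint algA LA strat) ?addr0 -?meetA ?meetCx ?meetx0//.
by apply: subalgebraI => //; exact: subalgebraC.
Qed.

(** If some bet is conditioned on [\top], the gain is averaged under [P]. Otherwise [P] may vanish
    on all the conditioning blocks, and the strategy given any one of them, here [H j0], takes its
    place. *)
Lemma coherent_of_product_rule (A L : set T) (P : T -> R) (sigma Q : T -> T -> R) :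
  is_subalgebra A -> L `<=` A -> (forall h, L h -> h <> \bot%O) ->
  (forall h k, L h -> L k -> h <> k -> h `/\ k = \bot%O) ->
  is_strategy A L sigma -> is_fa_probability A P ->
  (forall F h, A F -> L h -> P (F `/\ h) = sigma F h * P h) ->
  (forall F, A F -> Q F \top%O = P F) ->
  (forall F h, A F -> L h -> Q F h = sigma F h) ->
  is_coherent (A `*` ([set \top%O] `|` L)) Q.
Proof.
move=> algA LA L0 Ldisj strat probP prodP QP Qs.
have [s01 s1 sfa] := strat; split=> [F h|F h|].
- move=> [_ [/= ->|/L0//]] T0; have /eqP := fa1 probP.
  by rewrite T0 (fa0 algA probP) eq_sym oner_eq0.
- move=> [/= AF [->|Lh]]; last by rewrite Qs// s01.
  by rewrite QP// (fa_ge0 probP)// (fa_le1 algA probP).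
move=> n E H s n0 GEH; pose j0 := Ordinal n0.
have AE j : A (E j) by have [] := GEH j.
have AH j : A (H j).
  by have [_ [/= ->|/LA//]] := GEH j; exact: subalgebra1.
have [[j Hj]|noT] := pselect (exists j, H j = \top%O).
  apply: (gain_values_minimum_maximum (A := A) (P := P)) => // [k|].
    have [_ [/= ->|Lk]] := GEH k; last by rewrite Qs// prodP.
    by rewrite meetx1 QP// (fa1 probP) mulr1.
  have -> : (\join_(k < n) H k)%O = \top%O; last exact: fa1 probP.
  by apply/le_anti; rewrite lex1 -Hj (@joins_sup _ _ _ j xpredT H).
have LH j : L (H j) by have [_ [/= Hj|//]] := GEH j; case: noT; exists j.
have prob0 := sfa _ (LH j0).
have s00 : sigma (H j0) (H j0) = 1 by apply: s1; rewrite ?meetxx.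
apply: (gain_values_minimum_maximum (A := A) (P := sigma^~ (H j0))) => // [k|].
  (* If [H k] is [H j0], the product rule is the invariance of the strategy under meeting with
     [H j0]; otherwise both sides vanish. *)
  rewrite Qs//; have [->|/eqP Hk0] := eqVneq (H k) (H j0).
    by rewrite s00 mulr1 (strategy_meet algA LA strat).
  have Hk := Ldisj _ _ (LH k) (LH j0) Hk0.
  rewrite !(strategy_disjoint algA LA strat (h := H j0)) ?mulr0//.
    exact: subalgebraI.
  by rewrite -meetA Hk meetx0.
apply/le_anti; rewrite (fa_le1 algA prob0)/=; last exact: subalgebra_joins.
rewrite -s00; apply: (le_fa algA prob0) => //; first exact: subalgebra_joins.
exact: (@joins_sup _ _ _ j0 xpredT H isT).
Qed.

(** Removes coherence from the problem: from here on only additivity, agreement with [pi] and the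
    product rule matter. *)
Lemma joint_probabilitiesP (A AL L : set T) (sigma : T -> T -> R) (pi P : T -> R) :
  is_subalgebra A -> L `<=` A -> (forall h, L h -> h <> \bot%O) ->
  (forall h k, L h -> L k -> h <> k -> h `/\ k = \bot%O) ->
  is_strategy A L sigma ->
  joint_probabilities A AL L sigma pi P <->
  [/\ is_fa_probability A P, forall B, AL B -> P B = pi B &
      forall F h, A F -> L h -> P (F `/\ h) = sigma F h * P h].
Proof.
move=> algA LA L0 Ldisj strat; split=> -[probP Ppi].
  move=> [Q [cohQ QP Qs]]; split=> // F h AF Lh; have Ah := LA _ Lh.
  have AFh := subalgebraI algA AF Ah.
  rewrite -(QP _ Ah) -(QP _ AFh) -(Qs _ _ AF Lh).
  by apply: (coherent_product_rule cohQ); split=> //=; [left|right|left].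
move=> prodP; split=> //.
(* If [\top] is itself a block, the two prescriptions agree by the product rule at [\top]. *)
pose Q F h := if `[< L h >] then sigma F h else P F.
have Qs F h : A F -> L h -> Q F h = sigma F h by move=> _ Lh; rewrite /Q asboolT.
have QP F : A F -> Q F \top%O = P F.
  move=> AF; rewrite /Q; case: asboolP => // LT.
  by rewrite -[P F]/(P F) -[in RHS](meetx1 F) prodP// (fa1 probP) mulr1.
exists Q; split=> //; exact: (coherent_of_product_rule algA LA L0 Ldisj strat probP prodP).
Qed.

End Coherence.

(** * The blocks of a partition decide its complete atomic algebra *)

Section Decided.
Variables (d : Order.disp_t) (T : ctbDistrLatticeType d).

(* The elements of <L>^* decided by every [H i] already form a complete atomic
   algebra containing L, whose atoms are the [H i]. *)
Lemma complete_generated_decided (I : Type) (H : I -> T) (Lstar : set T)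
    (x : T) (i : I) :
  is_partition H -> is_complete_generated (range H) Lstar -> Lstar x ->
  (H i <= x)%O \/ H i `/\ x = \bot%O.
Proof.
move=> [H0 Hdisj [_ Hsup]] [[algL supL infL _] HL Lmin] Lx.
pose S := [set y | Lstar y /\ forall j, (H j <= y)%O \/ H j `/\ y = \bot%O].
have HS j : S (H j).
  split=> [|k]; first by apply: HL; exists j.
  by have [->|kj] := pselect (k = j); [left|right; exact: Hdisj].
suff Satomic : is_complete_atomic S.
  have HS' : range H `<=` S by move=> _ [j _ <-].
  by have [_] := Lmin S Satomic HS' x Lx; apply.
(* The complement of an event that misses every block is an upper bound of the blocks, hence
   [\top]. *)
have meet_partition y : y <> \bot%O -> exists j, H j `/\ y <> \bot%O.
  move=> y0; apply: contrapT => noj; apply: y0; apply/eqP.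
  rewrite -lex0 -compl1 lexC; apply: Hsup => _ [j _ <-].
  by rewrite -disj_leC; apply/eqP; apply: contrapT => jy; apply: noj; exists j.
split.
- split=> [||y [Ly yH]|y z [Ly yH] [Lz zH]|y z [Ly yH] [Lz zH]]; split=> [|j].
  + exact: subalgebra0.
  + exact: (subalgebra0 (subalgebra_decided (H j))).
  + exact: subalgebra1.
  + exact: (subalgebra1 (subalgebra_decided (H j))).
  + exact: subalgebraC.
  + exact: (subalgebraC (subalgebra_decided (H j)) (yH j)).
  + exact: subalgebraI.
  + exact: (subalgebraI (subalgebra_decided (H j)) (yH j) (zH j)).
  + exact: subalgebraU.
  + exact: (subalgebraU (subalgebra_decided (H j)) (yH j) (zH j)).
- move=> V VS; have [|y Ly ysup] := supL V; first by move=> z /VS[].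
  exists y => //; split=> // j; have [yub yle] := ysup.
  have [[z Vz jz]|noz] := pselect (exists2 z, V z & (H j <= z)%O).
    by left; apply: le_trans jz (yub _ Vz).
  (* Every member of [V] misses [H j], so the complement of [H j] is an upper bound of [V]. *)
  right; apply/eqP; rewrite disj_leC lexC; apply: yle => z Vz.
  rewrite lexC -disj_leC; have [_ /(_ j)[jz|->//]] := VS _ Vz.
  by case: noz; exists z.
- move=> V VS; have [|y Ly yinf] := infL V; first by move=> z /VS[].
  exists y => //; split=> // j; have [ylb yge] := yinf.
  have [[z Vz jz]|noz] := pselect (exists2 z, V z & H j `/\ z = \bot%O).
    by right; apply/eqP; rewrite -lex0 -jz leI2 ?ylb.
  left; apply: yge => z Vz; have [_ /(_ j)[//|jz]] := VS _ Vz.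
  by case: noz; exists z.
(* A block met by [y] lies below [y], and it is an atom because every element of [S] is decided by
   it. *)
- move=> y [Ly yH] /meet_partition[j jy]; exists (H j); last by have [|/jy] := yH j.
  split=> // z [_ /(_ j)[jz|jz]] zj; [right|left]; first by apply/le_anti; rewrite zj.
  by rewrite -jz (meet_r zj).
Qed.

End Decided.

(** * The supremum of the lower sums as a supermodular capacity *)

Section LowerSums.
Variables (R : realType) (d : Order.disp_t) (T : ctbDistrLatticeType d).
Variables (A AL L : set T) (sigma : T -> T -> R) (pi : T -> R).
Hypotheses (algA : is_subalgebra A) (algAL : is_subalgebra AL).
Hypotheses (LAL : L `<=` AL) (ALA : AL `<=` A).
Hypothesis Ldisj : forall h k, L h -> L k -> h <> k -> h `/\ k = \bot%O.
Hypothesis Ldec : forall h x, L h -> AL x -> (h <= x)%O \/ h `/\ x = \bot%O.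
Hypotheses (strat : is_strategy A L sigma) (prior : is_fa_probability AL pi).

Implicit Types (F B h : T) (K : seq T).

Let LA : L `<=` A. Proof. by move=> h /LAL /ALA. Qed.

Let sigma_fa h : L h -> is_fa_probability A (sigma^~ h).
Proof. by have [_ _] := strat; apply. Qed.

Local Notation Joins K := (\join_(h <- K) h)%O.

Lemma joins_AL K : [set` K] `<=` L -> AL (Joins K).
Proof.
move=> KL; rewrite big_seq; apply: subalgebra_joins => // h hK.
exact/LAL/KL.
Qed.

(** Cutting the blocks of [K] out of [B] inside the formula lets [K] grow while [B] stays fixed. *)
Definition lower_sum F K B : R :=
  \sum_(h <- K) sigma F h * pi h + pi (B `/\ ¬ Joins K).

Definition seq_lower_sums F : set R :=
  [set v | exists K B, [/\ uniq K, [set` K] `<=` L, AL B, (B <= F)%O &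
                           v = lower_sum F K B]].

(* Moving [h] from [B] to the list loses nothing since sigma(F|h) = 1 whenever
   [h] meets [B <= F]. *)
Lemma lower_sum_cons F h K B : A F -> L h -> [set` K] `<=` L -> AL B ->
  (B <= F)%O -> lower_sum F K B <= lower_sum F (h :: K) B.
Proof.
move=> AF Lh KL ALB BF; have ALh := LAL Lh; have ALJ := joins_AL KL.
have ALNJ := subalgebraC algAL ALJ; have ALBJ := subalgebraI algAL ALB ALNJ.
rewrite /lower_sum big_cons (fa_split algAL prior ALBJ ALh).
have -> : B `/\ ¬ Joins K `/\ ¬ h = B `/\ ¬ Joins (h :: K).
  by rewrite big_cons complU -meetA [X in _ `/\ X]meetC.
suff : pi (B `/\ ¬ Joins K `/\ h) <= sigma F h * pi h by lra.
have [hB|hB] := Ldec Lh ALB; last first.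
  rewrite meetAC [B `/\ h]meetC hB meet0x (fa0 algAL prior).
  by apply: mulr_ge0; [apply: (fa_ge0 (sigma_fa Lh))|apply: (fa_ge0 prior)].
have [_ s1 _] := strat.
rewrite s1// ?mul1r; last by rewrite meetC; apply/meet_l/(le_trans hB).
by apply: (le_fa algAL prior) => //; [exact: subalgebraI|exact: leIr].
Qed.

Lemma lower_sum_mono F K K' B : A F -> uniq K -> uniq K' -> {subset K <= K'} ->
  [set` K'] `<=` L -> AL B -> (B <= F)%O -> lower_sum F K B <= lower_sum F K' B.
Proof.
(* [K0] collects the new blocks, which are then added one at a time. *)
move=> AF uK uK' KK' K'L ALB BF; pose K0 := [seq h <- K' | h \notin K].
have K0K : perm_eq (K0 ++ K) K'.
  apply: uniq_perm => // [|h].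
    rewrite cat_uniq uK filter_uniq// andbT; apply/hasPn => h hK.
    by rewrite mem_filter hK.
  by rewrite mem_cat mem_filter; case: (boolP (h \in K)) => [/KK'|] /=; rewrite ?orbT ?orbF.
have <- : lower_sum F (K0 ++ K) B = lower_sum F K' B.
  by rewrite /lower_sum !(perm_big _ K0K).
have {uK uK' KK' K0K} : {subset K0 ++ K <= K'} by move=> h; rewrite (perm_mem K0K).
elim: K0 => //= h K0 IH K0K; apply: le_trans (IH _) _.
  by move=> k kK; apply: K0K; rewrite in_cons kK orbT.
apply: lower_sum_cons => // [|k kK]; first by apply/K'L/K0K/mem_head.
by apply/K'L/K0K; rewrite in_cons kK orbT.
Qed.

(** Since [sigma] is at most 1 and blocks are disjoint, the sum over [K] is at most the prior of
    their join; the remaining term lies in the complement. *)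
Lemma lower_sum_le1 F K B : A F -> uniq K -> [set` K] `<=` L -> AL B ->
  lower_sum F K B <= 1.
Proof.
move=> AF uK KL ALB; have ALJ := joins_AL KL; have ALNJ := subalgebraC algAL ALJ.
have : pi (B `/\ ¬ Joins K) <= 1 - pi (Joins K).
  rewrite -(faC algAL prior)//; apply: (le_fa algAL prior) => //.
    exact: subalgebraI.
  exact: leIr.
have -> : pi (Joins K) = \sum_(h <- K) pi h.
  apply: (fa_joins algAL prior) => // [h /KL /LAL//|h k /KL Lh /KL Lk /eqP].
  exact: Ldisj.
rewrite /lower_sum.
suff : \sum_(h <- K) sigma F h * pi h <= \sum_(h <- K) pi h by lra.
rewrite big_seq [leRHS]big_seq; apply: ler_sum => h /KL Lh.
rewrite ler_piMl//; first exact/(fa_ge0 prior)/LAL.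
by rewrite (fa_le1 algA (sigma_fa Lh)).
Qed.

Lemma seq_lower_sums0 F B : AL B -> (B <= F)%O -> seq_lower_sums F (pi B).
Proof.
move=> ALB BF; exists [::], B; split=> //.
by rewrite /lower_sum !big_nil add0r compl0 meetx1.
Qed.

Lemma seq_lower_sums_nonempty F : seq_lower_sums F !=set0.
Proof. by eexists; apply: (seq_lower_sums0 (subalgebra0 algAL)); exact: le0x. Qed.

Lemma seq_lower_sums_ubound F : A F -> has_ubound (seq_lower_sums F).
Proof.
by move=> AF; exists 1 => _ [K [B [uK KL ALB _ ->]]]; exact: lower_sum_le1.
Qed.

Lemma lower_sum_le_sup F K B : A F -> uniq K -> [set` K] `<=` L -> AL B ->
  (B <= F)%O -> lower_sum F K B <= sup (seq_lower_sums F).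
Proof.
move=> AF uK KL ALB BF; apply: (ub_le_sup (seq_lower_sums_ubound AF)).
by exists K, B.
Qed.

Lemma prior_le_sup F B : A F -> AL B -> (B <= F)%O -> pi B <= sup (seq_lower_sums F).
Proof.
move=> AF ALB BF; apply: (ub_le_sup (seq_lower_sums_ubound AF)).
exact: seq_lower_sums0.
Qed.

Lemma strategy_le_sup F h : A F -> L h ->
  sigma F h * pi h <= sup (seq_lower_sums F).
Proof.
move=> AF Lh; have hL : [set` [:: h]] `<=` L by move=> k /=; rewrite inE => /eqP ->.
have := @lower_sum_le_sup F [:: h] _ AF isT hL (subalgebra0 algAL) (le0x F).
by rewrite /lower_sum big_seq1 meet0x (fa0 algAL prior) addr0.
Qed.

Lemma seq_lower_sums_capacity :
  supermodular_capacity A (fun F => sup (seq_lower_sums F)).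
Proof.
have A0 := subalgebra0 algA; have A1 := subalgebra1 algA.
split=> [||F G AF AG FG|F G AF AG].
- apply/le_anti/andP; split; last first.
    by rewrite -{1}(fa0 algAL prior) prior_le_sup//; exact: subalgebra0.
  apply: ge_sup => [|_ [K [B [uK KL ALB B0 ->]]]]; first exact: seq_lower_sums_nonempty.
  have -> : B = \bot%O by apply/eqP; rewrite -lex0.
  rewrite /lower_sum meet0x (fa0 algAL prior) addr0 big_seq big1// => h /KL Lh.
  by rewrite (fa0 algA (sigma_fa Lh)) mul0r.
- apply/le_anti/andP; split.
    apply: ge_sup => [|_ [K [B [uK KL ALB _ ->]]]]; first exact: seq_lower_sums_nonempty.
    exact: lower_sum_le1.
  by rewrite -{1}(fa1 prior) prior_le_sup//; exact: subalgebra1.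
- apply: ge_sup => [|_ [K [B [uK KL ALB BF ->]]]]; first exact: seq_lower_sums_nonempty.
  apply: le_trans (lower_sum_le_sup AG uK KL ALB (le_trans BF FG)).
  rewrite lerD2r big_seq [leRHS]big_seq; apply: ler_sum => h /KL Lh.
  rewrite ler_wpM2r//; first exact/(fa_ge0 prior)/LAL.
  exact: (le_fa algA (sigma_fa Lh)).
apply: sup_add_le; [exact: seq_lower_sums_nonempty..|].
move=> _ _ [K1 [B [uK1 K1L ALB BF ->]]] [K2 [C [uK2 K2L ALC CG ->]]].
(* Both sums are enlarged to a common list of blocks, where [B] and [C] may be replaced by their
   join and meet. *)
pose K := undup (K1 ++ K2); have uK : uniq K := undup_uniq _.
have KL : [set` K] `<=` L.
  by move=> h /=; rewrite mem_undup mem_cat => /orP[/K1L|/K2L].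
have K1K : {subset K1 <= K} by move=> h hK; rewrite mem_undup mem_cat hK.
have K2K : {subset K2 <= K} by move=> h hK; rewrite mem_undup mem_cat hK orbT.
apply: le_trans (lerD (lower_sum_mono AF uK1 uK K1K KL ALB BF)
                      (lower_sum_mono AG uK2 uK K2K KL ALC CG)) _.
apply: le_trans (lerD
  (lower_sum_le_sup (subalgebraU algA AF AG) uK KL (subalgebraU algAL ALB ALC) (leU2 BF CG))
  (lower_sum_le_sup (subalgebraI algA AF AG) uK KL (subalgebraI algAL ALB ALC) (leI2 BF CG))).
(* Over the common [K] equality holds, since [pi] and each [sigma] given a block are modular. *)
rewrite le_eqVlt; apply/orP; left; apply/eqP.
have ALNJ := subalgebraC algAL (joins_AL KL).
have := fa_modular algAL prior (subalgebraI algAL ALB ALNJ) (subalgebraI algAL ALC ALNJ).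
rewrite -meetUl meetACA meetxx /lower_sum => modB.
suff : \sum_(h <- K) sigma F h * pi h + \sum_(h <- K) sigma G h * pi h =
  \sum_(h <- K) sigma (F `\/ G) h * pi h + \sum_(h <- K) sigma (F `/\ G) h * pi h by lra.
rewrite -!big_split big_seq [RHS]big_seq; apply: eq_bigr => h /KL Lh /=.
by rewrite -!mulrDl (fa_modular algA (sigma_fa Lh)).
Qed.

(** Lower bounds for an event and its complement, with the same total on both sides, must be
    equalities; this is used within [\top] and then within each block. *)
Lemma fa_above_product_rule P : is_fa_probability A P ->
  (forall F, A F -> sup (seq_lower_sums F) <= P F) ->
  (forall B, AL B -> P B = pi B) /\
  (forall F h, A F -> L h -> P (F `/\ h) = sigma F h * pi h).
Proof.
move=> probP supP.
have Ppi B : AL B -> P B = pi B.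
  move=> ALB; have AB := ALA ALB; have ALNB := subalgebraC algAL ALB.
  have := le_trans (prior_le_sup AB ALB (lexx B)) (supP _ AB).
  have ANB := ALA ALNB; have := le_trans (prior_le_sup ANB ALNB (lexx _)) (supP _ ANB).
  rewrite (faC algA probP)// (faC algAL prior)//; lra.
split=> // F h AF Lh; have Ah := LA Lh.
have bnd G : A G -> sigma G h * pi h <= P (G `/\ h).
  move=> AG; have AGh := subalgebraI algA AG Ah.
  by rewrite -(strategy_meet algA LA strat AG Lh) (le_trans (strategy_le_sup AGh Lh))// supP.
(* The bounds for [F] and its complement add up to [pi h], which is [P h]. *)
have := bnd _ AF; have := bnd _ (subalgebraC algA AF).
rewrite (faC algA (sigma_fa Lh))// mulrBl mul1r -(Ppi _ (LAL Lh)).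
rewrite [in X in X - _ <= _](fa_split algA probP Ah AF) ![h `/\ _]meetC; lra.
Qed.

End LowerSums.

(** * Lower sums over finite partitions *)

Section FiniteFamilies.
Variables (R : realType) (d : Order.disp_t) (T : ctbDistrLatticeType d).
Variables (I : Type) (H : I -> T) (A AL : set T).
Variables (sigma : T -> T -> R) (pi : T -> R).
Hypotheses (algA : is_subalgebra A) (algAL : is_subalgebra AL).
Hypotheses (HAL : range H `<=` AL) (ALA : AL `<=` A).
Implicit Types (F : T).

Lemma lower_sums_le_fa P F v : is_fa_probability A P -> A F ->
  (forall B, AL B -> P B = pi B) ->
  (forall h, range H h -> P (F `/\ h) = sigma F h * pi h) ->
  lower_sums H AL sigma pi F v -> v <= P F.
Proof.
move=> probP AF Ppi prodP [n [t [i [B [ALB [_ disj _] ->]]]]].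
(* Each term of the sum is the probability of a piece of [F] inside one cell of the partition; the
   [B b] not below [F] contribute [\bot]. *)
pose X (k : 'I_n + 'I_t) : T := match k with
  | inl a => F `/\ H (i a) | inr b => if (B b <= F)%O then B b else \bot%O end.
have AX k : A (X k).
  case: k => [a|b] /=; first by apply: subalgebraI => //; apply/ALA/HAL; exists (i a).
  by case: ifP => _; [exact/ALA|exact: subalgebra0].
have XF k : (X k <= finite_family H i B k)%O.
  by case: k => [a|b] /=; [exact: leIr|case: ifP => // _; exact: le0x].
have -> : \sum_(h < n) sigma F (H (i h)) * pi (H (i h)) +
    \sum_(k < t | (B k <= F)%O) pi (B k) = \sum_k P (X k).
  rewrite big_sumType /= [X in _ + X]big_mkcond; congr (_ + _).
    by apply: eq_bigr => a _; rewrite prodP//; exists (i a).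
  by apply: eq_bigr => b _; case: ifP => _; rewrite ?(fa0 algA probP)// Ppi.
rewrite -(fa_joins algA probP (in1W AX) (index_enum_uniq _)) => [|k l _ _ /eqP kl].
  apply: (le_fa algA probP) => //; first exact: subalgebra_joins.
  apply: joins_le => -[a|b] _ /=; first exact: leIl.
  by case: ifP => // _; exact: le0x.
by apply/eqP; rewrite -lex0 -(disj _ _ kl) leI2.
Qed.

Hypothesis Hdisj : forall k l, k <> l -> H k `/\ H l = \bot%O.
Hypothesis prior : is_fa_probability AL pi.

Lemma range_disj h k : range H h -> range H k -> h <> k -> h `/\ k = \bot%O.
Proof. by move=> [i _ <-] [j _ <-] ij; apply: Hdisj => ij'; apply: ij; rewrite ij'. Qed.

(** The blocks in [K] are completed to a partition by the rest of [C] and the rest of its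
    complement. The latter may also lie below [F], which explains the inequality. *)
Lemma seq_lower_sums_le F v : (forall k, H k <> \bot%O) ->
  seq_lower_sums AL (range H) sigma pi F v ->
  exists2 v', lower_sums H AL sigma pi F v' & v <= v'.
Proof.
move=> H0 [K [C [uK KL ALC CF ->]]].
have [a|i iK] := @choice _ _ (fun (a : 'I_(size K)) j => H j = nth \bot%O K a).
  by have [j _ <-] := KL _ (mem_nth \bot%O (ltn_ord a)); exists j.
set J := (\join_(h <- K) h)%O.
have ALJ : AL J by apply: (joins_AL algAL HAL).
have ALNJ := subalgebraC algAL ALJ; have ALNC := subalgebraC algAL ALC.
pose b := C `/\ ¬ J; pose c := ¬ C `/\ ¬ J.
have ALb : AL b by exact: subalgebraI.
have ALc : AL c by exact: subalgebraI.
have bc0 : b `/\ c = \bot%O by rewrite /b /c meetACA meetxC meet0x.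
(* A partition has no impossible member, so either remainder is dropped when it is [\bot]. *)
pose s := [seq x <- [:: b; c] | x != \bot%O].
have sALJ x : x \in s -> [/\ x != \bot%O, AL x & (x <= ¬ J)%O].
  rewrite mem_filter !inE => /andP[x0 /orP[]/eqP xE]; subst x; split=> //;
  exact: leIr.
have us : uniq s.
  rewrite /s /=; case: ifPn => // b0; case: ifPn => //= c0.
  rewrite inE andbT; apply: contra b0 => /eqP bcE.
  by rewrite -bc0 -bcE meetxx.
have sdisj x y : x \in s -> y \in s -> x != y -> x `/\ y = \bot%O.
  rewrite !mem_filter !inE => /andP[_ /orP[]/eqP ->] /andP[_ /orP[]/eqP ->] //;
  by rewrite ?eqxx// meetC.
pose B (k : 'I_(size s)) := nth \bot%O s k.
have Bs k : B k \in s by exact: mem_nth.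
exists (\sum_(h < size K) sigma F (H (i h)) * pi (H (i h)) +
        \sum_(k < size s | (B k <= F)%O) pi (B k)).
  exists (size K), (size s), i, B; split=> // [k|]; first by have [] := sALJ _ (Bs k).
  have iJ a : (H (i a) <= J)%O.
    by rewrite iK; exact: (joins_sup_seq id (mem_nth _ (ltn_ord a)) isT).
  have BNJ a l : H (i a) `/\ B l = \bot%O.
    apply/eqP; rewrite disj_leC (le_trans (iJ a))// lexC.
    by have [] := sALJ _ (Bs l).
  split=> [[a|l]|[a|l] [a'|l'] kl|] /=.
  - exact: H0.
  - by apply/eqP; have [] := sALJ _ (Bs l).
  - rewrite !iK; apply: range_disj; [exact/KL/mem_nth..|].
    by move/eqP; rewrite nth_uniq// => /eqP/ord_inj aa; apply: kl; rewrite aa.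
  - exact: BNJ.
  - by rewrite meetC BNJ.
  - apply: sdisj => //; rewrite nth_uniq//; apply/eqP => /ord_inj ll.
    by apply: kl; rewrite ll.
  - split=> [x _|u uub]; first exact: lex1.
    (* A dropped remainder is [\bot] and lies below [u] trivially, so [u] bounds both remainders in
       every case. *)
    have su x : x \in [:: b; c] -> (x <= u)%O.
      move=> xbc; have [->|x0] := eqVneq x \bot%O; first exact: le0x.
      have xs : x \in s by rewrite mem_filter x0.
      have xlt : (index x s < size s)%N by rewrite index_mem.
      by apply: uub; exists (inr (Ordinal xlt)) => //; rewrite /= /B /= nth_index.
    have -> : \top%O = J `\/ (b `\/ c).
      by rewrite -meetUl joinxC meet1x joinxC.
    have bu : (b <= u)%O by apply: su; exact: mem_head.
    have cu : (c <= u)%O by apply: su; rewrite !inE eqxx orbT.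
    rewrite !leUx bu cu !andbT.
    rewrite /J big_seq; apply: joins_le => h hK.
    have hlt : (index h K < size K)%N by rewrite index_mem.
    by apply: uub; exists (inl (Ordinal hlt)) => //; rewrite /= iK /= nth_index.
have -> : \sum_(h < size K) sigma F (H (i h)) * pi (H (i h)) =
    \sum_(h <- K) sigma F h * pi h.
  rewrite (big_nth \bot%O) big_mkord; apply: eq_bigr => a _.
  by rewrite iK.
rewrite lerD2l.
have -> : \sum_(k < size s | (B k <= F)%O) pi (B k) = \sum_(x <- s | (x <= F)%O) pi x.
  by rewrite (big_nth \bot%O) big_mkord.
have [b0|b0] := eqVneq b \bot%O.
  rewrite -/J -/b b0 (fa0 algAL prior) big_seq_cond sumr_ge0// => x /andP[xs _].
  by apply: (fa_ge0 prior); have [] := sALJ _ xs.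
rewrite /s /= b0 big_cons -/J -/b.
have -> : (b <= F)%O by rewrite /b (le_trans _ CF) ?leIl.
rewrite lerDl big_seq_cond sumr_ge0// => x /andP[xs _].
by apply: (fa_ge0 prior); have [|//] := sALJ x; rewrite /s /= b0 in_cons xs orbT.
Qed.

End FiniteFamilies.

(** * Attainment of the lower envelope *)

Theorem theorem2 (R : realType) (d : Order.disp_t) (T : ctbDistrLatticeType d)
    (I J : Type) (H : I -> T) (E : J -> T)
    (AL AE A Lstar Estar Astar : set T)
    (sigma : T -> T -> R) (pi : T -> R)
    (partL : is_partition H) (partE : is_partition E)
    (LstarP : is_complete_generated (range H) Lstar)
    (EstarP : is_complete_generated (range E) Estar)
    (AstarP : is_complete_generated (AL `|` AE) Astar)
    (algAL : is_subalgebra AL) (algAE : is_subalgebra AE)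
    (algA : is_subalgebra A)
    (AL_ge : generated (range H) `<=` AL) (AL_le : AL `<=` Lstar)
    (AE_ge : generated (range E) `<=` AE) (AE_le : AE `<=` Estar)
    (A_ge : generated (AL `|` AE) `<=` A) (A_le : A `<=` Astar)
    (strat : is_strategy A (range H) sigma)
    (prior : is_fa_probability AL pi) :
  forall F, A F ->
    is_minimum [set P F | P in joint_probabilities A AL (range H) sigma pi]
               (sup (lower_sums H AL sigma pi F)).
Proof.
move=> F AF; have [H0 Hdisj _] := partL.
have HAL : range H `<=` AL by move=> h Hh; apply: AL_ge; apply: sub_gen_smallest.
have ALA : AL `<=` A by move=> B ALB; apply: A_ge; apply: sub_gen_smallest; left.
have HA : range H `<=` A := subset_trans HAL ALA.
have L0 h : range H h -> h <> \bot%O by move=> [i _ <-]; exact: H0.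
have Ldisj := range_disj Hdisj.
have Ldec h x : range H h -> AL x -> (h <= x)%O \/ h `/\ x = \bot%O.
  by move=> [i _ <-] /AL_le; exact: complete_generated_decided partL LstarP.
have lowP P : joint_probabilities A AL (range H) sigma pi P ->
    ubound (lower_sums H AL sigma pi F) (P F).
  move=> /(joint_probabilitiesP _ _ _ algA HA L0 Ldisj strat)[probP Ppi prodP] v.
  apply: (lower_sums_le_fa algA HAL ALA) => // h Hh.
  by rewrite prodP// Ppi//; exact: HAL.
have lowW v : seq_lower_sums AL (range H) sigma pi F v ->
    exists2 w, lower_sums H AL sigma pi F w & v <= w.
  exact: seq_lower_sums_le.
have low0 : lower_sums H AL sigma pi F !=set0.
  have [v Wv] : seq_lower_sums AL (range H) sigma pi F !=set0.
    exact: seq_lower_sums_nonempty.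
  by have [w low_w _] := lowW v Wv; exists w.
have cap := seq_lower_sums_capacity algA algAL HAL Ldisj Ldec strat prior.
(* This [P] depends on [F]: it lies above the capacity everywhere on [A] and touches it at [F]. *)
have [P [probP supP PF]] := supermodular_capacity_touch algA cap AF.
have [Ppi prodP] := fa_above_product_rule algA algAL HAL ALA Ldisj strat prior probP supP.
have jointP : joint_probabilities A AL (range H) sigma pi P.
  apply/(joint_probabilitiesP _ _ _ algA HA L0 Ldisj strat); split=> // G h AG Hh.
  by rewrite prodP// Ppi//; exact: HAL.
split=> [|_ [P' jointP' <-]]; last by apply: ge_sup => //; exact: lowP.
exists P => //; apply/le_anti/andP; split; last by apply: ge_sup => //; exact: lowP.
(* Each sum over a list of blocks is dominated by one over a finite partition, so passing to
   partitions does not lower the supremum. *)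
apply: le_trans PF _; apply: ge_sup => [|v /lowW[w low_w vw]].
  exact: seq_lower_sums_nonempty.
by apply: le_trans vw (ub_le_sup _ low_w); exists (P F); exact: lowP.
Qed.
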